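(* Let $M$ be a hypermodular matroid of rank $4$ on ground set $E$, and let $l_1,l_2$ be two disjoint coplanar lines of $M$. (i) The following are equivalent: (a) there is a single-element extension $M'$ of $M$ in which $\operatorname{cl}_{M'}(l_1)$ and $\operatorname{cl}_{M'}(l_2)$ intersect (in a point); (b) the modular cut generated by $l_1$ and $l_2$ in $M$ contains a set of pairwise coplanar lines, $l_1$ and $l_2$ among them, that partition $E$. (ii) If a single-element extension $M'$ as in (i)(a) exists, then the restriction to $E$ of any line of $M'$ is a line of $M$. (iii) If no single-element extension as in (i)(a) exists, then $M$ contains two non-coplanar lines $l_3,l_4$ such that $l_i$ and $l_j$ are coplanar for all $i\in\{1,2\}$, $j\in\{3,4\}$, and no three of $l_1,l_2,l_3,l_4$ are coplanar.
   Context: Lines and planes are flats of rank $2$ and $3$; two lines are coplanar if their union has rank $3$. A pair $(X,Y)$ of flats is modular if $\operatorname{rk}(X)+\operatorname{rk}(Y)=\operatorname{rk}(X\cup Y)+\operatorname{rk}(X\cap Y)$; a matroid is hypermodular if every pair of hyperplanes is modular. A modular cut of $M$ is a set of flats closed under taking flat supersets and such that the intersection of any two members forming a modular pair is a member; the modular cut generated by a set of flats is the smallest modular cut containing it. Single-element extensions of $M$ correspond bijectively to modular cuts, the cut consisting of the flats of $M$ whose closure contains the new element. *)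

(* Defs.v *)
From mathcomp Require Export all_boot.
From mathcomp Require Export boolp classical_sets functions cardinality.

Set Implicit Arguments.
Unset Strict Implicit.
Unset Printing Implicit Defensive.

Local Open Scope classical_set_scope.
Local Open Scope card_scope.

(* Matroids of finite rank on the ground set [setT : set T], given by their
   rank function.  [T] may be infinite: [rk_finitary] then says that the rank
   of a set is attained on a finite subset (it is void when [T] is finite), and
   the remaining fields are the usual rank axioms (0 <= rk A <= |A|,
   monotonicity, submodularity). *)
Record matroid (T : Type) := Matroid {
  rk :> set T -> nat;
  rk_card : forall A n, A #<= `I_n -> rk A <= n;
  rk_mono : forall A B, A `<=` B -> rk A <= rk B;
  rk_submod : forall A B, rk (A `|` B) + rk (A `&` B) <= rk A + rk B;
  rk_finitary : forall A, exists B, [/\ B `<=` A, finite_set B & rk B = rk A]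
}.

Section Matroid.
Context {T : Type}.
Implicit Types (M : matroid T) (A F X Y : set T) (C : set (set T)).

Definition cl M A : set T := [set x | rk M (x |` A) = rk M A].

Definition flat M F : Prop := cl M F = F.

Definition point M F : Prop := flat M F /\ rk M F = 1.

Definition line M F : Prop := flat M F /\ rk M F = 2.

Definition hyperplane M F : Prop := flat M F /\ (rk M F).+1 = rk M setT.

(* To be applied to the union of the lines: [l] and [l'] are coplanar when
   [coplanar M (l `|` l')], and similarly for three lines. *)
Definition coplanar M A : Prop := rk M A = 3.

Definition modular_pair M X Y : Prop :=
  rk M X + rk M Y = rk M (X `|` Y) + rk M (X `&` Y).

Definition hypermodular M : Prop :=
  forall X Y, hyperplane M X -> hyperplane M Y -> modular_pair M X Y.

Definition modular_cut M C : Prop :=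
  [/\ C `<=` flat M,
      forall X Y, C X -> flat M Y -> X `<=` Y -> C Y
    & forall X Y, C X -> C Y -> modular_pair M X Y -> C (X `&` Y)].

Definition generated_cut M C : set (set T) := smallest (modular_cut M) C.

End Matroid.

(* The ground set of a single-element extension is [option T]: [None] is the
   new element and [Some] embeds the ground set [T] of [M]; the condition says
   that deleting [None] from [M'] gives [M]. *)
Definition single_element_extension (T : Type)
    (M : matroid T) (M' : matroid (option T)) : Prop :=
  forall A : set T, rk M' (Some @` A) = rk M A.

(* The intersection has to be a point: a new element that is a loop lies in
   both closures, but does not make the lines meet. *)
Definition meeting_extension (T : Type) (M : matroid T) (l1 l2 : set T)
    (M' : matroid (option T)) : Prop :=
  single_element_extension M M' /\
  point M' (cl M' (Some @` l1) `&` cl M' (Some @` l2)).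

(* Main.v *)
Require Import Defs.
From mathcomp Require Import all_boot.
From mathcomp Require Import boolp classical_sets functions cardinality.
From mathcomp Require Import zify.

(* Both (a) and (b) are equivalent to the modular cut G generated by [l1] and
   [l2] not containing the empty flat.  If G omits the empty flat, then the
   extension it defines makes the lines meet; it contains no point, since
   a point together with one of the [li] not through it is a modular pair with
   empty intersection; hence its lines are pairwise disjoint and coplanar, and
   intersecting planes of G puts one of them through each point.  Conversely,
   the flats containing some line of a partition into pairwise coplanar lines
   form a modular cut without the empty flat.
   For (iii), let P be the plane spanned by [l1] and [l2]; each [p] outside P is
   on the line in which the planes spanned by [p] with [l1] and with [l2] meet.
   If two of these transversals are not coplanar they are [l3] and [l4].
   Otherwise they extend to a partition as above, by adding the traces on P of
   the other planes containing a transversal. *)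

Set Implicit Arguments.
Unset Strict Implicit.
Unset Printing Implicit Defensive.

Local Open Scope classical_set_scope.

(** Reduces the cardinality axiom of a rank function to an increase of at most one per added
    element; meant for the rank of the extension. *)
Lemma leq_of_card_le {T : Type} (f : set T -> nat) (A : set T) n :
    f set0 = 0 -> (forall x B, f (x |` B) <= (f B).+1) ->
  (A #<= `I_n)%card -> f A <= n.
Proof.
move=> f0 fS An.
have /finite_setP[m Am] : finite_set A by apply/finite_set_leP; exists n.
have mn : m <= n by rewrite -card_le_II -(card_le_eql Am).
apply: leq_trans mn; elim: m A Am {An} => [|m IH] A Am.
  by move: Am; rewrite II0 card_eq0 => /eqP->; rewrite f0.
have [x Ax /IH Axm] := eq_cardSP _ _ Am.
rewrite -(setD1K Ax); exact: leq_trans (fS _ _) _.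
Qed.

(** * Closure and flats in matroids of finite rank *)

Section Flats.
Context {T : Type} (M : matroid T).
Implicit Types (A B F X Y : set T) (x : T).

Lemma rk_set0 : rk M set0 = 0.
Proof. by apply/eqP; rewrite -leqn0; apply: rk_card; rewrite II0 card_le0. Qed.

Lemma rk_setU1 x A : rk M (x |` A) <= (rk M A).+1.
Proof.
have x1 : rk M [set x] <= 1 by apply: rk_card; rewrite (card_le_eql card_set1).
have := rk_submod M [set x] A; lia.
Qed.

Lemma subset_cl A : A `<=` cl M A.
Proof. by move=> x Ax; rewrite /cl/= setUidr// => _ ->. Qed.

(** Submodularity allows adding elements of the closure one at a time. For infinite [B], finitarity
    first provides a finite [D] with the rank of the whole union. *)
Lemma rk_setU_cl A B : B `<=` cl M A -> rk M (A `|` B) = rk M A.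
Proof.
move=> BA; apply/eqP; rewrite eqn_leq [X in _ && X]rk_mono ?andbT; last exact: subsetUl.
have [D [DAB /finite_setP[n Dn] <-]] := rk_finitary M (A `|` B).
have {B BA DAB} DA : D `<=` cl M A.
  by move=> x /DAB[|/BA//]; apply: subset_cl.
apply: (@leq_trans (rk M (A `|` D))); first by apply: rk_mono; exact: subsetUr.
elim: n D Dn DA => [|n IH] D Dn DA.
  by move: Dn; rewrite II0 card_eq0 => /eqP->; rewrite setU0.
have [x Dx /IH {}IH] := eq_cardSP _ _ Dn.
have {}IH : rk M (A `|` D `\ x) <= rk M A by apply: IH => y [/DA].
have := rk_submod M (A `|` D `\ x) (x |` A).
have -> : A `|` D `\ x `|` (x |` A) = A `|` D.
  rewrite -{2}(setD1K Dx); apply/seteqP; split=> y /=; tauto.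
have : rk M A <= rk M ((A `|` D `\ x) `&` (x |` A)).
  by apply: rk_mono => y Ay; split; [left|right].
have : rk M (x |` A) = rk M A by exact: DA.
lia.
Qed.

Lemma rk_cl A : rk M (cl M A) = rk M A.
Proof. by have := @rk_setU_cl A (cl M A) (fun _ => id);
  rewrite setUidr//; apply: subset_cl. Qed.

Lemma cl_mono A B : A `<=` B -> cl M A `<=` cl M B.
Proof.
move=> AB x xA; apply/eqP; rewrite eqn_leq [X in _ && X]rk_mono ?andbT; last first.
  exact: subsetUr.
have := rk_submod M (x |` A) B; rewrite -setUA (setUidr AB).
have : rk M A <= rk M ((x |` A) `&` B).
  by apply: rk_mono => y Ay; split; [right|apply: AB].
have : rk M (x |` A) = rk M A by exact: xA.
lia.
Qed.

Lemma sub_cl_of_rk A B : A `<=` B -> rk M B <= rk M A -> B `<=` cl M A.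
Proof.
move=> AB BA x Bx; apply/eqP; rewrite eqn_leq [X in _ && X]rk_mono ?andbT; last first.
  exact: subsetUr.
by apply: leq_trans BA; apply: rk_mono => y [->|/AB].
Qed.

Lemma cl_eq A B : A `<=` B -> rk M B <= rk M A -> cl M A = cl M B.
Proof.
move=> AB BA; apply/seteqP; split; first exact: cl_mono.
by apply: sub_cl_of_rk; rewrite ?rk_cl//; apply: subset_trans AB ((@subset_cl B)).
Qed.

Lemma flat_cl A : flat M (cl M A).
Proof. by rewrite /flat -(@cl_eq A) ?rk_cl//; apply: subset_cl. Qed.

Lemma flatI X Y : flat M X -> flat M Y -> flat M (X `&` Y).
Proof.
move=> fX fY; apply/seteqP; split; last exact: subset_cl.
by rewrite subsetI; split; [rewrite -[Z in _ `<=` Z]fX|rewrite -[Z in _ `<=` Z]fY];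
  apply: cl_mono => x [].
Qed.

Lemma cl_sub_flat A F : flat M F -> A `<=` F -> cl M A `<=` F.
Proof. by move=> fF AF; rewrite -[Z in _ `<=` Z]fF; apply: cl_mono. Qed.

Lemma flat_max F A : flat M F -> F `<=` A -> rk M A <= rk M F -> F = A.
Proof.
by move=> fF FA AF; apply/seteqP; split=> //;
  rewrite -[Z in _ `<=` Z]fF; apply: sub_cl_of_rk.
Qed.

Lemma rk_flatU1 x F : flat M F -> ~ F x -> rk M (x |` F) = (rk M F).+1.
Proof.
move=> fF nFx; have := rk_setU1 x F.
have : ~ rk M (x |` F) <= rk M F.
  move=> /(flat_max fF (@subsetUr _ _ _)) e; apply: nFx.
  by rewrite e; left.
lia.
Qed.

Lemma rk_flatU X Y : flat M X -> flat M Y -> rk M X = rk M Y -> X <> Y ->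
  rk M X < rk M (X `|` Y).
Proof.
move=> fX fY XY nXY; rewrite ltnNge; apply/negP => le; apply: nXY.
rewrite (flat_max fX (@subsetUl _ _ _) le) -(flat_max fY (@subsetUr _ _ _))//.
by rewrite -XY.
Qed.

End Flats.

(** * From a modular cut to a single-element extension *)

Section Extension.
Context {T : Type} (M : matroid T) (C : set (set T)).
Context (cutC : modular_cut M C).
Implicit Types (A B : set T).

(** The amount by which the new element is to raise the rank of [A]. *)
Let defect A : bool := `[< ~ C (cl M A) >].

Let defect_anti A B : A `<=` B -> defect B <= defect A.
Proof.
have [_ Cup _] := cutC.
move=> AB; rewrite /defect; case: asboolP => // nB; case: asboolP => // nA.
case: nB; move/contrapT: nA => CA; apply: Cup CA _ _; first exact: flat_cl.
exact: cl_mono.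
Qed.

(** If submodularity of [rk M] is strict on [A], [B], the slack of one absorbs the defects. In the
    case of equality, the closures form a modular pair meeting in the closure of [A] and [B]'s
    intersection, so the cut contains the latter when it contains both closures. *)
Let defect_submod A B :
  rk M (A `|` B) + defect (A `|` B) + (rk M (A `&` B) + defect (A `&` B)) <=
  rk M A + defect A + (rk M B + defect B).
Proof.
have [CF _ CI] := cutC.
have sub := rk_submod M A B.
have := defect_anti (@subsetUl _ A B); have := defect_anti (@subsetUr _ A B).
have := defect_anti (@subIsetl _ A B); have := defect_anti (@subIsetr _ A B).
case: (pselect (rk M (A `|` B) + rk M (A `&` B) = rk M A + rk M B)) => [eqAB|]; last first.
  by lia.
suff : defect (A `&` B) <= defect A + defect B.
  by lia.
rewrite /defect; case: asboolP => // nI; case: asboolP => // /contrapT CA.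
case: asboolP => // /contrapT CB; case: nI.
have subU : cl M A `|` cl M B `<=` cl M (A `|` B).
  by rewrite subUset; split; apply: cl_mono; [exact: subsetUl|exact: subsetUr].
have subI : A `&` B `<=` cl M A `&` cl M B by apply: setISS; apply: subset_cl.
have leU := rk_mono M subU; rewrite rk_cl in leU.
have geU : rk M (A `|` B) <= rk M (cl M A `|` cl M B).
  by apply: rk_mono; apply: setUSS; apply: subset_cl.
have leI := rk_mono M subI.
have := rk_submod M (cl M A) (cl M B); rewrite !rk_cl => sub'.
rewrite (cl_eq subI); last lia.
suff : C (cl M A `&` cl M B) by move=> CAB; rewrite (CF _ CAB).
by apply: CI => //; rewrite /modular_pair !rk_cl; lia.
Qed.

Let extrk (A : set (option T)) : nat :=
  rk M (Some @^-1` A) + `[< A None >] && defect (Some @^-1` A).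

Let extrk_mono (A B : set (option T)) : A `<=` B -> extrk A <= extrk B.
Proof.
move=> AB; have AB' : Some @^-1` A `<=` Some @^-1` B by move=> x /AB.
have := rk_mono M AB'; rewrite /extrk.
(* Traces of equal rank have the same closure, hence the same defect; otherwise the gain in rank
   pays for a defect of [A]. *)
have [le _|lt _] := leqP (rk M (Some @^-1` B)) (rk M (Some @^-1` A)).
  rewrite /defect (cl_eq AB' le); apply: leq_add; first exact: rk_mono.
  by case: (asboolP (A None)) => // /AB BN; rewrite (asboolT BN).
by case: (`[< A None >] && _) => /=; lia.
Qed.

Let extrk_submod (A B : set (option T)) :
  extrk (A `|` B) + extrk (A `&` B) <= extrk A + extrk B.
Proof.
rewrite /extrk preimage_setU preimage_setI !asbool_or asbool_and.
have := defect_submod (Some @^-1` A) (Some @^-1` B).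
have := rk_submod M (Some @^-1` A) (Some @^-1` B).
have := defect_anti (@subsetUl _ (Some @^-1` A) (Some @^-1` B)).
have := defect_anti (@subsetUr _ (Some @^-1` A) (Some @^-1` B)).
by case: `[< A None >]; case: `[< B None >] => /=; lia.
Qed.

Let extrk_card (A : set (option T)) n : (A #<= `I_n)%card -> extrk A <= n.
Proof.
apply: leq_of_card_le => [|x B]; rewrite /extrk.
  by rewrite preimage_set0 rk_set0 asboolF.
case: x => [x|].
  have -> : Some @^-1` (Some x |` B) = x |` Some @^-1` B.
    by apply/seteqP; split=> y /= [[->]|]; [left|right|left|right].
  have -> : `[< (Some x |` B) None >] = `[< B None >].
    by apply: asbool_equiv_eq; split=> [[]//|]; right.
  have := rk_setU1 M x (Some @^-1` B).
  have := defect_anti (@subsetUr _ [set x] (Some @^-1` B)).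
  by case: `[< B None >] => /=; lia.
have -> : Some @^-1` (None |` B) = Some @^-1` B.
  by apply/seteqP; split=> y /= => [[]//|]; right.
by case: (_ && defect _) => /=; lia.
Qed.

Let extrk_finitary (A : set (option T)) :
  exists B : set (option T), [/\ B `<=` A, finite_set B & extrk B = extrk A].
Proof.
have [D [DA Dfin rkD]] := rk_finitary M (Some @^-1` A).
(* [D] has the same closure as the trace of [A], hence the same defect; the new element is added
   exactly when [A] contains it. *)
exists (Some @` D `|` (A `&` [set None])); split.
- by rewrite subUset; split=> [_ [x /DA Ax <-]|x []].
- rewrite finite_setU; split; first exact: finite_image.
  by apply: sub_finite_set (finite_set1 None) => x [].
- have e : Some @^-1` (Some @` D `|` (A `&` [set None])) = D.
    by apply/seteqP; split=> x /= => [[[y ? [<-]]|[]]|Dx]//; left; exists x.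
  have eN : (Some @` D `|` (A `&` [set None])) None <-> A None.
    by split=> [[[]|[]]//|AN]; right.
  by rewrite /extrk e (asbool_equiv_eq eN) rkD /defect (cl_eq DA) ?rkD.
Qed.

Lemma modular_cut_extension : exists M' : matroid (option T),
  single_element_extension M M' /\
  forall A, rk M' (None |` Some @` A) = rk M A + `[< ~ C (cl M A) >].
Proof.
have SomeK A : Some @^-1` (Some @` A) = A.
  by apply/seteqP; split=> x /= => [[y ? [<-]]//|Ax]; exists x.
exists (Matroid extrk_card extrk_mono extrk_submod extrk_finitary).
split=> A /=; rewrite /extrk.
  by rewrite SomeK asboolF ?addn0// => -[].
rewrite preimage_setU SomeK asboolT; last by left.
suff -> : Some @^-1` [set None] = set0 :> set T by rewrite set0U.
by apply/seteqP; split.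
Qed.

End Extension.

(** Both closure conditions pass to intersections of modular cuts. The members are flats because the
    set of all flats is itself a modular cut containing [C]. *)
Lemma generated_cut_modular {T : Type} (M : matroid T) (C : set (set T)) :
  C `<=` flat M -> modular_cut M (generated_cut M C).
Proof.
move=> CF; have cutF : modular_cut M (flat M).
  by split=> // X Y fX fY _; exact: flatI.
split=> [|X Y CX fY XY|X Y CX CY XYmod]; first exact: smallest_sub.
- by move=> D cD; have [[_ Dup _] _] := cD; exact: Dup (CX D cD) fY XY.
- by move=> D cD; have [[_ _ DI] _] := cD; exact: DI (CX D cD) (CY D cD) XYmod.
Qed.

(** * From a single-element extension to a modular cut *)

Section ExtensionFlats.
Context {T : Type} (M : matroid T) (M' : matroid (option T)).
Context (ext : single_element_extension M M').

Lemma extension_cl_Some A x : cl M' (Some @` A) (Some x) -> cl M A x.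
Proof.
rewrite /cl/= -some_set1 -some_setU => e.
by rewrite -ext -[RHS]ext.
Qed.

Lemma extension_flat (F : set (option T)) : flat M' F -> flat M (Some @^-1` F).
Proof.
move=> fF; apply/seteqP; split; last exact: subset_cl.
move=> x; rewrite /cl/= -!ext some_setU some_set1 => Fx.
suff : cl M' F (Some x) by rewrite fF.
by apply: (@cl_mono _ _ (Some @` (Some @^-1` F))) => // _ [y Fy <-].
Qed.

(** These are the flats whose closure in [M'] contains the new element. For a modular pair,
    submodularity in [M'] leaves no room for the new element to raise the rank of the
    intersection. *)
Lemma extension_cut :
  modular_cut M [set F | flat M F /\ rk M' (None |` Some @` F) = rk M F].
Proof.
split=> [F []//|X Y [fX eX] fY XY|X Y [fX eX] [fY eY] XYmod]; split=> //=.
- apply/eqP; rewrite eqn_leq -{2}(ext Y) [Z in _ && Z]rk_mono ?andbT; last exact: subsetUr.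
  have := rk_submod M' (None |` Some @` X) (Some @` Y).
  rewrite -setUA (setUidr (image_subset _ XY)) eX (ext Y).
  have : rk M X <= rk M' ((None |` Some @` X) `&` Some @` Y).
    rewrite -ext; apply: rk_mono; rewrite subsetI; split; first exact: subsetUr.
    exact: image_subset.
  lia.
- exact: flatI.
- apply/eqP; rewrite eqn_leq -{2}(ext (X `&` Y)) [Z in _ && Z]rk_mono ?andbT; last first.
    exact: subsetUr.
  have := rk_submod M' (None |` Some @` X) (None |` Some @` Y).
  rewrite -setUUr -some_setU -setUIr -some_setI eX eY.
  have : rk M (X `|` Y) <= rk M' (None |` Some @` (X `|` Y)).
    by rewrite -ext; apply: rk_mono; exact: subsetUr.
  by move: XYmod; rewrite /modular_pair; lia.
Qed.

End ExtensionFlats.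

(** * Lines and planes *)

Definition plane {T : Type} (M : matroid T) (X : set T) : Prop :=
  flat M X /\ rk M X = 3.

Lemma line_neq0 {T : Type} (M : matroid T) (l : set T) : line M l -> l !=set0.
Proof. by move=> [_ rkl]; apply/set0P/eqP => l0; move: rkl; rewrite l0 rk_set0. Qed.

Section LinesAndPlanes.
Context {T : Type} (M : matroid T).
Implicit Types (l m X Y : set T) (x : T).

Lemma line_eq l m : line M l -> line M m -> l `<=` m -> l = m.
Proof. by move=> [fl rl] [_ rm] lm; apply: (flat_max fl lm); rewrite rl rm. Qed.

Lemma plane_eq X Y : plane M X -> plane M Y -> X `<=` Y -> X = Y.
Proof. by move=> [fX rX] [_ rY] XY; apply: (flat_max fX XY); rewrite rX rY. Qed.

Lemma plane_cl l x : line M l -> ~ l x -> plane M (cl M (x |` l)).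
Proof.
move=> [fl rl] lx; split; first exact: flat_cl.
by rewrite rk_cl (rk_flatU1 fl lx) rl.
Qed.

Lemma sub_plane_cl l x : l `<=` cl M (x |` l).
Proof. by move=> y ly; apply: subset_cl; right. Qed.

Lemma mem_plane_cl l x : cl M (x |` l) x.
Proof. by apply: subset_cl; left. Qed.

Lemma plane_clE l x X :
  line M l -> ~ l x -> plane M X -> l `<=` X -> X x -> cl M (x |` l) = X.
Proof.
move=> ll lx pX lX Xx; apply: (plane_eq (plane_cl ll lx) pX).
by case: pX => fX _; apply: cl_sub_flat => // y [->|/lX].
Qed.

Lemma leq3_rk_linesU l m : line M l -> line M m -> l <> m -> 3 <= rk M (l `|` m).
Proof.
move=> [fl rl] [fm rm] lm.
by have := rk_flatU fl fm (etrans rl (esym rm)) lm; rewrite rl.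
Qed.

Lemma lines_coplanar X l m : plane M X -> line M l -> line M m -> l <> m ->
  l `<=` X -> m `<=` X -> coplanar M (l `|` m).
Proof.
move=> [_ rX] ll lm nlm lX mX; have := leq3_rk_linesU ll lm nlm.
have : rk M (l `|` m) <= rk M X by apply: rk_mono; rewrite subUset.
by rewrite /coplanar; lia.
Qed.

(** [l] and one point of [m] off [l] already span the plane of both lines. *)
Lemma coplanar_sub l m x X : line M l -> coplanar M (l `|` m) ->
  flat M X -> l `<=` X -> m x -> ~ l x -> X x -> m `<=` X.
Proof.
move=> [fl rl] lm fX lX mx lx Xx.
have xlX : x |` l `<=` X by rewrite subUset; split=> // _ ->.
apply: subset_trans (cl_sub_flat fX xlX); have -> : cl M (x |` l) = cl M (l `|` m).
  apply: cl_eq; first by move=> y [->|ly]; [right|left].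
  by rewrite lm (rk_flatU1 fl lx) rl.
by move=> y my; apply: subset_cl; right.
Qed.

(** * The modular cut of a partition into pairwise coplanar lines *)

Section PartitionIntoLines.
Context (L : set (set T)).
Context (L_line : L `<=` line M).
Context (L_copl : forall l l', L l -> L l' -> l <> l' -> coplanar M (l `|` l')).
Context (L_part : partition L id setT).

Let L_eq l l' x : L l -> L l' -> l x -> l' x -> l = l'.
Proof. by case: L_part => _ triv _ Ll Ll' lx l'x; apply: triv => //; exists x. Qed.

Let L_cover x : exists2 l, L l & l x.
Proof. by case: L_part => cov _ _; have : setT x by []; rewrite -cov. Qed.

Let above_line : set (set T) := [set F | flat M F /\ exists2 l, L l & l `<=` F].

(** By coplanarity, members of the cut are unions of lines of [L]; two members with a common point
    thus share the line of [L] through it. *)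
Let absorb X x : above_line X -> X x -> exists l, [/\ L l, l x & l `<=` X].
Proof.
move=> [fX [l Ll lX]] Xx; have [l' Ll' l'x] := L_cover x; exists l'; split=> //.
have [<-//|ll'] := pselect (l = l').
have lx : ~ l x by move=> lx; apply: ll'; apply: L_eq lx l'x.
exact: (coplanar_sub (L_line Ll) (L_copl Ll Ll' ll') fX lX l'x).
Qed.

Lemma partition_cut : modular_cut M above_line.
Proof.
split=> [F []//|X Y [_ [l Ll lX]] fY XY|X Y cX cY XYmod].
  by split=> //; exists l => //; apply: subset_trans XY.
split; first exact: flatI cX.1 cY.1.
have [[x [Xx Yx]]|XY0] := pselect (X `&` Y !=set0).
  have [l [Ll lx lX]] := absorb cX Xx; have [l' [Ll' l'x l'Y]] := absorb cY Yx.
  by exists l => //; rewrite subsetI; split=> //; rewrite (L_eq Ll Ll' lx l'x).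
(* Disjoint members are never a modular pair: adding [l'] to [X] raises the rank by at most 1, as
   [l] lies in [X], and [Y] then adds at most [rk M Y - 2]. *)
have rXY0 : rk M (X `&` Y) = 0.
  suff -> : X `&` Y = set0 by exact: rk_set0.
  by apply: contrapT => /eqP/set0P.
case: cX cY => [_ [l Ll lX]] [_ [l' Ll' l'Y]].
have ll' : l <> l'.
  move=> e; have [x lx] := line_neq0 (L_line Ll).
  by apply: XY0; exists x; split; [exact: lX|apply: l'Y; rewrite -e].
have cll' : rk M (l `|` l') = 3 := L_copl Ll Ll' ll'.
have [[_ rl] [_ rl']] := (L_line Ll, L_line Ll').
have rXll' := rk_submod M X (l `|` l').
have : rk M l <= rk M (X `&` (l `|` l')).
  by apply: rk_mono; rewrite subsetI; split=> //; exact: subsetUl.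
have rXl' : rk M (X `|` l') <= rk M (X `|` (l `|` l')).
  by apply: rk_mono; apply: setUS; exact: subsetUr.
have := rk_submod M (X `|` l') Y; rewrite -setUA (setUidr l'Y).
have : rk M l' <= rk M ((X `|` l') `&` Y).
  by apply: rk_mono; rewrite subsetI; split=> //; exact: subsetUr.
by move: XYmod; rewrite /modular_pair rl rl'; lia.
Qed.

Lemma partition_generated_cut l1 l2 :
  L l1 -> L l2 -> ~ generated_cut M [set l1; l2] set0.
Proof.
move=> Ll1 Ll2 /(smallest_sub partition_cut)[|_ [l Ll]].
  by move=> _ [|] ->; split; [exact: (L_line Ll1).1|exists l1|exact: (L_line Ll2).1|exists l2].
by rewrite subset0 => l0; have [x] := line_neq0 (L_line Ll); rewrite l0.
Qed.

End PartitionIntoLines.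

End LinesAndPlanes.

(** * Transversals of two disjoint coplanar lines in rank 4 *)

Section HypermodularRank4.
Context {T : Type} (M : matroid T).
Context (M_hyper : hypermodular M) (M_rank : rk M setT = 4).
Implicit Types (l m X Y : set T) (x : T).

Lemma plane_modular X Y : plane M X -> plane M Y -> modular_pair M X Y.
Proof.
by move=> [fX rX] [fY rY]; apply: M_hyper; split; rewrite // M_rank ?rX ?rY.
Qed.

(** The union has rank 4, so modularity leaves rank 3 + 3 - 4 for the intersection. *)
Lemma line_planeI X Y : plane M X -> plane M Y -> X <> Y -> line M (X `&` Y).
Proof.
move=> pX pY XY; have XYmod := plane_modular pX pY.
case: pX pY => [fX rX] [fY rY]; split; first exact: flatI.
have := rk_flatU fX fY (etrans rX (esym rY)) XY.
have := rk_mono M (@subsetT _ (X `|` Y)).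
by move: XYmod; rewrite /modular_pair; lia.
Qed.

Lemma exists_notin_plane X : plane M X -> exists q, ~ X q.
Proof.
move=> [_ rX]; apply/not_existsP => H; move: M_rank.
suff -> : setT = X by rewrite rX.
by apply/seteqP; split=> // q _; apply: contrapT.
Qed.

Section TwoLines.
Context (l1 l2 : set T).
Context (l1_line : line M l1) (l2_line : line M l2).
Context (l12_disj : l1 `&` l2 = set0) (l12_copl : coplanar M (l1 `|` l2)).

Let P := cl M (l1 `|` l2).

Let plane_P : plane M P.
Proof. by split; [exact: flat_cl|rewrite rk_cl]. Qed.

Let l1P : l1 `<=` P. Proof. by move=> x l1x; apply: subset_cl; left. Qed.
Let l2P : l2 `<=` P. Proof. by move=> x l2x; apply: subset_cl; right. Qed.

Let disj12 x : l1 x -> l2 x -> False.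
Proof. by move=> l1x l2x; have : (l1 `&` l2) x by []; rewrite l12_disj. Qed.

(** A loop would lie in every flat, in particular in the disjoint [l1] and [l2]. *)
Lemma rk_eq0 A : rk M A = 0 -> A = set0.
Proof.
move=> A0; apply/seteqP; split=> // x Ax.
have : cl M set0 x by rewrite (@cl_eq _ _ set0 A) ?A0//; exact: subset_cl.
by move/(cl_sub_flat (flatI l1_line.1 l2_line.1) (@sub0set _ _)); rewrite l12_disj.
Qed.

(* In an extension where [l1] and [l2] meet, the line joining [p] to the new
   point. *)
Definition transversal p : set T := cl M (p |` l1) `&` cl M (p |` l2).

Let notinP_l1 p : ~ P p -> ~ l1 p. Proof. by move=> Pp /l1P. Qed.
Let notinP_l2 p : ~ P p -> ~ l2 p. Proof. by move=> Pp /l2P. Qed.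

Let plane_l1 p : ~ P p -> plane M (cl M (p |` l1)).
Proof. by move=> /notinP_l1; exact: plane_cl. Qed.
Let plane_l2 p : ~ P p -> plane M (cl M (p |` l2)).
Proof. by move=> /notinP_l2; exact: plane_cl. Qed.

Lemma mem_transversal p : transversal p p.
Proof. by split; exact: mem_plane_cl. Qed.

Let neq_planeP p X : ~ P p -> X p -> X <> P.
Proof. by move=> Pp Xp e; apply: Pp; rewrite -e. Qed.

Lemma transversal_line p : ~ P p -> line M (transversal p).
Proof.
move=> Pp; apply: line_planeI; [exact: plane_l1|exact: plane_l2|move=> e].
apply: (@neq_planeP p (cl M (p |` l1))) => //; first exact: mem_plane_cl.
apply/esym/(plane_eq plane_P (plane_l1 Pp)).
apply: cl_sub_flat; first exact: flat_cl.
by rewrite subUset; split; [|rewrite e]; exact: sub_plane_cl.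
Qed.

Lemma plane_l1_trace p : ~ P p -> P `&` cl M (p |` l1) = l1.
Proof.
move=> Pp; apply/esym/(@line_eq _ M) => //;
  last by rewrite subsetI; split=> //; exact: sub_plane_cl.
apply: line_planeI => //; first exact: plane_l1.
by apply/nesym/(neq_planeP Pp)/mem_plane_cl.
Qed.

Lemma plane_l2_trace p : ~ P p -> P `&` cl M (p |` l2) = l2.
Proof.
move=> Pp; apply/esym/(@line_eq _ M) => //;
  last by rewrite subsetI; split=> //; exact: sub_plane_cl.
apply: line_planeI => //; first exact: plane_l2.
by apply/nesym/(neq_planeP Pp)/mem_plane_cl.
Qed.

(** The two planes defining the transversal meet [P] in [l1] and in [l2], which are disjoint. *)
Lemma transversal_notin p x : ~ P p -> transversal p x -> ~ P x.
Proof.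
move=> Pp [x1 x2] Px; apply: (@disj12 x).
  by rewrite -(plane_l1_trace Pp).
by rewrite -(plane_l2_trace Pp).
Qed.

(** [q] spans with [l1] and with [l2] the same planes as [p]. Hence the transversals partition the
    complement of [P]. *)
Lemma transversal_eq p q : ~ P p -> transversal p q -> transversal q = transversal p.
Proof.
move=> Pp pq; have Pq := transversal_notin Pp pq; case: pq => q1 q2.
rewrite /transversal (plane_clE l1_line _ (plane_l1 Pp))
  ?(plane_clE l2_line _ (plane_l2 Pp))//.
all: by first [exact: sub_plane_cl | exact: notinP_l1 | exact: notinP_l2].
Qed.

Lemma transversal_coplanar p : ~ P p ->
  coplanar M (l1 `|` transversal p) /\ coplanar M (l2 `|` transversal p).
Proof.
move=> Pp; have ltr := transversal_line Pp; have pp := mem_transversal p; split.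
  apply: (lines_coplanar (plane_l1 Pp)) => //; [|exact: sub_plane_cl|by move=> x []].
  by move=> e; apply: (notinP_l1 Pp); rewrite e.
apply: (lines_coplanar (plane_l2 Pp)) => //; [|exact: sub_plane_cl|by move=> x []].
by move=> e; apply: (notinP_l2 Pp); rewrite e.
Qed.

Lemma transversal_not_coplanar p : ~ P p ->
  ~ coplanar M (l1 `|` l2 `|` transversal p).
Proof.
move=> Pp copl; apply: Pp; rewrite /P (@cl_eq _ _ _ (l1 `|` l2 `|` transversal p)).
- by apply: subset_cl; right; exact: mem_transversal.
- exact: subsetUl.
- by rewrite copl l12_copl.
Qed.

(** * Lines of a modular cut that omits the empty flat *)

Section ProperCut.
Context (D : set (set T)) (cutD : modular_cut M D).
Context (Dl1 : D l1) (Dl2 : D l2) (D0 : ~ D set0).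

Lemma cut_transversal p : ~ P p -> D (transversal p).
Proof.
have [_ Dup DI] := cutD; move=> Pp; apply: DI.
- by apply: (Dup l1) => //; [exact: flat_cl|exact: sub_plane_cl].
- by apply: (Dup l2) => //; [exact: flat_cl|exact: sub_plane_cl].
- by apply: plane_modular; [exact: plane_l1|exact: plane_l2].
Qed.

Lemma cut_cover x : exists m, [/\ line M m, D m & m x].
Proof.
have [_ Dup DI] := cutD; have [Px|Px] := pselect (P x); last first.
  by exists (transversal x); split;
    [exact: transversal_line|exact: cut_transversal|exact: mem_transversal].
(* For [x] in [P], the plane through [x] and the transversal of an outside point lies in [D], being
   above a member, and cuts [P] in the required line. *)
have [q Pq] := exists_notin_plane plane_P.
have lq := transversal_line Pq.
have qx : ~ transversal q x by move=> /(transversal_notin Pq).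
have pX := plane_cl lq qx.
exists (P `&` cl M (x |` transversal q)); split.
- apply: line_planeI => //; apply/nesym/(neq_planeP Pq)/sub_plane_cl.
  exact: mem_transversal.
- apply: DI; last exact: plane_modular.
  + by apply: (Dup l1) => //; exact: plane_P.1.
  + by apply: (Dup _ _ (cut_transversal Pq)); [exact: flat_cl|exact: sub_plane_cl].
- by split=> //; exact: mem_plane_cl.
Qed.

(** If [Q] is not inside [li], their union has rank 3 and they form a modular pair with empty
    intersection, which [D] omits. But [Q] cannot be inside both lines. *)
Lemma cut_not_point Q : D Q -> rk M Q <> 1.
Proof.
have [DF Dup DI] := cutD; move=> DQ rQ.
have in_li l : line M l -> D l -> Q `<=` l.
  move=> [fl rl] Dl; apply: contrapT => Ql; apply: D0.
  have fQ := DF _ DQ.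
  have lt2 : rk M l < rk M (Q `|` l).
    rewrite ltnNge; apply/negP => le; apply: Ql.
    by rewrite (flat_max fl (@subsetUr _ Q l) le); exact: subsetUl.
  have sub := rk_submod M Q l.
  have QlD : D (Q `&` l) by apply: DI => //; rewrite /modular_pair; lia.
  suff <- : Q `&` l = set0 by [].
  by apply: rk_eq0; lia.
have : rk M Q <= rk M set0.
  by apply: rk_mono; rewrite -l12_disj subsetI; split; exact: in_li.
by rewrite rk_set0 rQ.
Qed.

(** Distinct lines through [x] have a union of rank 3 and an intersection of rank 1, so modularity
    would put a point in [D]. *)
Lemma cut_line_eq m m' x : line M m -> line M m' -> D m -> D m' -> m x -> m' x ->
  m = m'.
Proof.
have [_ _ DI] := cutD; move=> lm lm' Dm Dm' mx m'x; apply: contrapT => mm'.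
have le3 := leq3_rk_linesU lm lm' mm'.
have sub := rk_submod M m m'; have [[_ rm] [_ rm']] := (lm, lm').
have : 0 < rk M (m `&` m').
  rewrite lt0n; apply/eqP => /rk_eq0 I0.
  by have : (m `&` m') x by []; rewrite I0.
move=> gt0; apply: (@cut_not_point (m `&` m')); last lia.
by apply: DI => //; rewrite /modular_pair; lia.
Qed.

(** Distinct lines of [D] are disjoint; if they spanned rank 4 they would be a modular pair, putting
    the empty flat in [D]. *)
Lemma cut_lines_coplanar m m' : line M m -> line M m' -> D m -> D m' ->
  m <> m' -> coplanar M (m `|` m').
Proof.
have [_ _ DI] := cutD; move=> lm lm' Dm Dm' mm'.
have le3 := leq3_rk_linesU lm lm' mm'.
have I0 : m `&` m' = set0.
  by apply/seteqP; split=> // x [mx m'x]; apply: mm'; apply: cut_line_eq mx m'x.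
apply: contrapT => n3; apply: D0; rewrite -I0; apply: DI => //.
have := rk_submod M m m'; rewrite /modular_pair I0 rk_set0 lm.2 lm'.2.
by move: n3; rewrite /coplanar; lia.
Qed.

End ProperCut.

(** * The generated cut and the extensions in which the lines meet *)

Let G := generated_cut M [set l1; l2].

Let cutG : modular_cut M G.
Proof. by apply: generated_cut_modular => _ [] ->; [exact: l1_line.1|exact: l2_line.1]. Qed.
Let Gl1 : G l1. Proof. by apply: sub_gen_smallest; left. Qed.
Let Gl2 : G l2. Proof. by apply: sub_gen_smallest; right. Qed.

Lemma generated_cut_partition : ~ G set0 ->
  let L := [set l | line M l /\ G l] in
  (forall l l', L l -> L l' -> l <> l' -> coplanar M (l `|` l')) /\
  partition L id setT.
Proof.
move=> G0 L; split.
  by move=> l l' [ll Gl] [ll' Gl'] nll'; exact: (cut_lines_coplanar cutG Gl1 Gl2 G0).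
split=> [|l l' [ll Gl] [ll' Gl'] [x [lx l'x]]|l [/line_neq0]//].
  apply/seteqP; split=> // x _; have [m [lm Gm mx]] := cut_cover cutG Gl1 Gl2 x.
  by exists m.
exact: (cut_line_eq cutG Gl1 Gl2 G0 ll ll' Gl Gl' lx l'x).
Qed.

Lemma meeting_extension_of_cut :
  ~ G set0 -> exists M', meeting_extension M l1 l2 M'.
Proof.
move=> G0; have [M' [ext rkN]] := modular_cut_extension cutG.
have NoneP l : flat M l -> G l -> cl M' (Some @` l) None.
  by move=> fl Gl; rewrite /cl/= rkN fl asboolF ?addn0// => /(_ Gl).
exists M'; split=> //.
have I1 : cl M' (Some @` l1) `&` cl M' (Some @` l2) = [set None].
  apply/seteqP; split=> [[x [/(extension_cl_Some ext) x1
    /(extension_cl_Some ext) x2]|//]|_ ->].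
    by case: (@disj12 x); [rewrite -l1_line.1|rewrite -l2_line.1].
  by split; apply: NoneP => //; first [exact: l1_line.1 | exact: l2_line.1].
split; first by apply: flatI; exact: flat_cl.
(* Since [G] omits the empty flat, the new element is not a loop and the intersection has rank 1. *)
have cl0 : cl M set0 = set0 by apply: rk_eq0; rewrite rk_cl rk_set0.
by rewrite I1 -(setU0 [set None]) -some_set0 rkN cl0 rk_set0 asboolT.
Qed.

(** The common point can only be the new element, as [l1] and [l2] are disjoint in [M]. So both
    lines belong to the cut of the extension, which then contains [G]. *)
Lemma generated_cut_of_extension M' : meeting_extension M l1 l2 M' ->
  rk M' [set None] = 1 /\
  G `<=` [set F | flat M F /\ rk M' (None |` Some @` F) = rk M F].
Proof.
move=> [ext [_ rI]].
have I1 : cl M' (Some @` l1) `&` cl M' (Some @` l2) = [set None].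
  have sub1 : cl M' (Some @` l1) `&` cl M' (Some @` l2) `<=` [set None].
    move=> [x [/(extension_cl_Some ext) x1 /(extension_cl_Some ext) x2]|//].
    by case: (@disj12 x); [rewrite -l1_line.1|rewrite -l2_line.1].
  apply/seteqP; split=> // _ ->.
  have /set0P[x Ix] : cl M' (Some @` l1) `&` cl M' (Some @` l2) != set0.
    by apply/eqP => I0; move: rI; rewrite I0 rk_set0.
  by rewrite -(sub1 _ Ix).
split; first by rewrite -I1.
apply: smallest_sub; first exact: extension_cut.
have [N1 N2] : (cl M' (Some @` l1) `&` cl M' (Some @` l2)) None by rewrite I1.
by move=> _ [] ->; split; rewrite -?(ext l1) -?(ext l2) //; [exact: l1_line.1|exact: l2_line.1].
Qed.

Lemma generated_cut_proper M' : meeting_extension M l1 l2 M' -> ~ G set0.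
Proof.
move=> /generated_cut_of_extension[r1 sub] /sub[_].
by rewrite some_set0 setU0 r1 rk_set0.
Qed.

(** Otherwise [l] is the new element together with a point of [M]. The line [m] of [G] through that
    point has the new element in its closure, so [l] is [m] with the new element and its trace is
    [m] after all. *)
Lemma line_of_meeting_extension M' (l : set (option T)) :
  meeting_extension M l1 l2 M' -> line M' l -> line M (Some @^-1` l).
Proof.
move=> mext [fl rl]; have [ext _] := mext.
have [rN subG] := generated_cut_of_extension mext.
have G0 := generated_cut_proper mext.
set l0 := Some @^-1` l; have fl0 : flat M l0 by exact: extension_flat.
split=> //; apply: contrapT => r2.
have l0l : Some @` l0 `<=` l by move=> _ [x lx <-].
have r0 : rk M l0 <= 1 by have := rk_mono M' l0l; rewrite ext rl; lia.
have lN : l `<=` None |` Some @` l0.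
  by move=> [x|] lx; [right; exists x|left].
have {}lN : l = None |` Some @` l0.
  apply/seteqP; split=> // _ [->|/l0l//]; apply: contrapT => nlN.
  apply: r2; rewrite -ext -rl; congr (rk M' _); apply/seteqP; split=> // y ly.
  by case: (lN _ ly) => // yN; case: nlN; rewrite -yN.
have [p l0p] : l0 !=set0.
  apply/set0P/eqP => e; move: rl; rewrite lN e some_set0 setU0 rN //.
have [m [lm Gm mp]] := cut_cover cutG Gl1 Gl2 p.
have l0m : l0 `<=` m.
  apply: (@subset_trans _ (cl M [set p])).
    apply: sub_cl_of_rk; first by move=> _ ->.
    rewrite (leq_trans r0)// lt0n; apply/eqP => /rk_eq0 e.
    by have : [set p] p by []; rewrite e.
  by apply: cl_sub_flat lm.1 _ => _ ->.
have [_ rNm] := subG _ Gm.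
have lNm : l = None |` Some @` m.
  apply: (flat_max fl); last by rewrite rNm lm.2 rl.
  by rewrite lN; apply: setUS; exact: image_subset.
apply: r2; suff -> : l0 = m by exact: lm.2.
apply/seteqP; split=> // x mx; rewrite /l0/= lNm; right; by exists x.
Qed.

(** * A partition into lines when all transversals are coplanar *)

Section CoplanarTransversals.
(** The bound also covers equal transversals, whose union has rank 2. *)
Context (transversal_rk : forall p q, ~ P p -> ~ P q ->
  rk M (transversal p `|` transversal q) <= 3).

Lemma transversals_coplanar p q : ~ P p -> ~ P q ->
  transversal p <> transversal q -> coplanar M (transversal p `|` transversal q).
Proof.
move=> Pp Pq pq; have := transversal_rk Pp Pq.
have := leq3_rk_linesU (transversal_line Pp) (transversal_line Pq) pq.
by rewrite /coplanar; lia.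
Qed.

(** By coplanarity, a flat containing one transversal is, outside [P], a union of transversals. *)
Lemma transversal_sub q r X : ~ P q -> flat M X -> transversal q `<=` X ->
  ~ P r -> X r -> transversal r `<=` X.
Proof.
move=> Pq fX qX Pr Xr; have [qr|qr] := pselect (transversal q r).
  by rewrite (transversal_eq Pq qr).
apply: (coplanar_sub (transversal_line Pq) _ fX qX (mem_transversal r) qr Xr).
apply: transversals_coplanar => // e; apply: qr.
by rewrite e; exact: mem_transversal.
Qed.

Let trace_plane X :=
  [/\ plane M X, X <> P & exists2 q, ~ P q & transversal q `<=` X].

Let trace_line X : trace_plane X -> line M (P `&` X).
Proof. by case=> pX XP _; apply: line_planeI => //; exact: nesym. Qed.

(** Distinct [X] and [Y] meet in a line. If it lies in [P], it is both traces. Otherwise it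
    contains, and so equals, the transversal of one of its points outside [P]; but it passes through
    [p], while transversals miss [P]. *)
Lemma trace_eq X Y p : trace_plane X -> trace_plane Y ->
  P p -> X p -> Y p -> P `&` X = P `&` Y.
Proof.
move=> tX tY Pp Xp Yp.
have [pX XP [q Pq qX]] := tX; have [pY YP [q' Pq' q'Y]] := tY.
have [->//|XY] := pselect (X = Y).
have lXY := line_planeI pX pY XY.
have [sub|] := pselect (X `&` Y `<=` P).
  transitivity (X `&` Y).
    by apply/esym/(line_eq lXY (trace_line tX)) => x XYx; split; [exact: sub|exact: XYx.1].
  by apply: (line_eq lXY (trace_line tY)) => x XYx; split; [exact: sub|exact: XYx.2].
move=> /existsNP[r /not_implyP[[Xr Yr] Pr]].
have rXY : transversal r `<=` X `&` Y.
  rewrite subsetI; split; first exact: transversal_sub Pq pX.1 qX Pr Xr.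
  exact: transversal_sub Pq' pY.1 q'Y Pr Yr.
have [] := @transversal_notin r p Pr => //.
by rewrite (line_eq (transversal_line Pr) lXY rXY).
Qed.

Let trace_transversal_coplanar X q : trace_plane X -> ~ P q ->
  coplanar M ((P `&` X) `|` transversal q).
Proof.
move=> tX Pq; have lX := trace_line tX; have [p [Pp Xp]] := line_neq0 lX.
have lq := transversal_line Pq.
have qp : ~ transversal q p by move=> /(transversal_notin Pq).
(* This plane contains the transversal of [q] and, by [trace_eq], has the same trace on [P] as
   [X]. *)
have tY : trace_plane (cl M (p |` transversal q)).
  split; [exact: plane_cl| |by exists q => //; exact: sub_plane_cl].
  apply: (neq_planeP Pq); apply: sub_plane_cl; exact: mem_transversal.
rewrite (trace_eq tX tY Pp Xp (@mem_plane_cl _ _ _ _)).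
have [pY _ _] := tY.
apply: (lines_coplanar pY (trace_line tY) lq); [|by move=> x []|exact: sub_plane_cl].
move=> e; have [] := @transversal_notin q p Pq => //; rewrite -e.
by split=> //; exact: mem_plane_cl.
Qed.

Let family : set (set T) := [set l |
  (exists2 q, ~ P q & l = transversal q) \/
  (exists2 X, trace_plane X & l = P `&` X)].

Lemma coplanar_transversals_partition : exists L : set (set T),
  [/\ L `<=` line M, L l1 /\ L l2,
      forall l l', L l -> L l' -> l <> l' -> coplanar M (l `|` l')
    & partition L id setT].
Proof.
have family_line : family `<=` line M.
  by move=> _ [[q Pq ->]|[X tX ->]]; [exact: transversal_line|exact: trace_line].
exists family; split=> //.
(* Each [li] is the trace of the plane it spans with an outside point [q], and that plane contains
   the transversal of [q]. *)
- have [q Pq] := exists_notin_plane plane_P; split; right.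
    exists (cl M (q |` l1)); last by rewrite plane_l1_trace.
    split; [exact: plane_l1|exact/(neq_planeP Pq)/mem_plane_cl|].
    by exists q => // x [].
  exists (cl M (q |` l2)); last by rewrite plane_l2_trace.
  split; [exact: plane_l2|exact/(neq_planeP Pq)/mem_plane_cl|].
  by exists q => // x [].
- move=> l l' fl fl'; have [ll ll'] := (family_line _ fl, family_line _ fl').
  case: fl fl' => [[q Pq ->]|[X tX ->]] [[q' Pq' ->]|[X' tX' ->]] nll'.
  + exact: transversals_coplanar.
  + by rewrite setUC; exact: trace_transversal_coplanar.
  + exact: trace_transversal_coplanar.
  + by apply: (lines_coplanar plane_P) => //; exact: trace_line.
- split=> [|l l' fl fl' [x [lx l'x]]|l /family_line/line_neq0//].
    apply/seteqP; split=> // x _; have [Px|Px] := pselect (P x); last first.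
      by exists (transversal x); [left; exists x|exact: mem_transversal].
    have [q Pq] := exists_notin_plane plane_P.
    have qx : ~ transversal q x by move=> /(transversal_notin Pq).
    exists (P `&` cl M (x |` transversal q)); last by split=> //; exact: mem_plane_cl.
    right; exists (cl M (x |` transversal q)) => //.
    split; [exact: plane_cl (transversal_line Pq) qx| |by exists q => //; exact: sub_plane_cl].
    by apply/(neq_planeP Pq)/sub_plane_cl/mem_transversal.
  move: lx l'x; case: fl fl' => [[q Pq ->]|[X tX ->]] [[q' Pq' ->]|[X' tX' ->]] /=.
  + by move=> qx q'x; rewrite -(transversal_eq Pq qx) (transversal_eq Pq' q'x).
  + by move=> /(transversal_notin Pq) Px [].
  + by move=> [Px _] /(transversal_notin Pq').
  + by move=> [Px Xx] [_ X'x]; exact: trace_eq Px Xx X'x.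
Qed.

End CoplanarTransversals.

End TwoLines.
End HypermodularRank4.

Theorem theorem10 (T : Type) (M : matroid T) (l1 l2 : set T)
    (M_hyper : hypermodular M) (M_rank : rk M setT = 4)
    (l1_line : line M l1) (l2_line : line M l2)
    (l12_disj : l1 `&` l2 = set0) (l12_copl : coplanar M (l1 `|` l2)) :
  [/\ (* (i) *)
      (exists M' : matroid (option T), meeting_extension M l1 l2 M') <->
      (exists L : set (set T),
         [/\ L `<=` generated_cut M [set l1; l2],
             L `<=` line M,
             L l1 /\ L l2,
             forall l l', L l -> L l' -> l <> l' -> coplanar M (l `|` l')
           & partition L id setT]),
      (* (ii) *)
      forall M' : matroid (option T), meeting_extension M l1 l2 M' ->
        forall l : set (option T), line M' l -> line M (Some @^-1` l)
    & (* (iii) *)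
      ~ (exists M' : matroid (option T), meeting_extension M l1 l2 M') ->
      exists l3 l4 : set T,
        [/\ line M l3 /\ line M l4,
            l3 <> l4 /\ ~ coplanar M (l3 `|` l4),
            coplanar M (l1 `|` l3) /\ coplanar M (l1 `|` l4),
            coplanar M (l2 `|` l3) /\ coplanar M (l2 `|` l4)
          & [/\ ~ coplanar M (l1 `|` l2 `|` l3),
                ~ coplanar M (l1 `|` l2 `|` l4),
                ~ coplanar M (l1 `|` l3 `|` l4)
              & ~ coplanar M (l2 `|` l3 `|` l4)]]].
Proof.
split.
- split=> [[M' /(generated_cut_proper l1_line l2_line l12_disj) G0]|
    [L [_ Ll [L1 L2] Lc Lp]]].
    have [Lc Lp] := generated_cut_partition
      M_hyper M_rank l1_line l2_line l12_disj l12_copl G0.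
    exists [set l | line M l /\ generated_cut M [set l1; l2] l]; split=> //.
    + by move=> l [].
    + by move=> l [].
    + by split; split=> //; apply: sub_gen_smallest; [left|right].
  exact: (meeting_extension_of_cut l1_line l2_line l12_disj
    (partition_generated_cut Ll Lc Lp L1 L2)).
- by move=> M' mext l; exact: line_of_meeting_extension mext.
move=> noext; pose P := cl M (l1 `|` l2).
pose t := transversal M l1 l2.
have [[p [q [Pp Pq rpq]]]|H] :=
    pselect (exists p q, [/\ ~ P p, ~ P q & ~ rk M (t p `|` t q) <= 3]); last first.
  have [p q Pp Pq|L [Ll [L1 L2] Lc Lp]] := @coplanar_transversals_partition _ _
      M_hyper M_rank _ _ l1_line l2_line l12_disj l12_copl.
    by apply: contrapT => rpq; apply: H; exists p, q.
  case: noext.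
  exact: (meeting_extension_of_cut l1_line l2_line l12_disj
    (partition_generated_cut Ll Lc Lp L1 L2)).
(* The two transversals together have rank above 3, which rules out every coplanar triple containing
   both. *)
have big A : t p `|` t q `<=` A -> ~ coplanar M A.
  by move=> sub cA; apply: rpq; rewrite -cA; exact: rk_mono.
have [p1 p2] := transversal_coplanar M_hyper M_rank l1_line l2_line l12_copl Pp.
have [q1 q2] := transversal_coplanar M_hyper M_rank l1_line l2_line l12_copl Pq.
exists (t p), (t q); split=> //.
- by split; exact: transversal_line.
- split; last exact: big.
  move=> e; apply: rpq; rewrite e setUid.
  by rewrite (transversal_line M_hyper M_rank l1_line l2_line l12_copl Pq).2.
- split; [exact: transversal_not_coplanar|exact: transversal_not_coplanar| |].
  + by apply: big; rewrite -setUA; exact: subsetUr.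
  + by apply: big; rewrite -setUA; exact: subsetUr.
Qed.
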